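(* Let $P_{1}\in \mathcal{SH}^{n}_{\infty}$, $P_{2}\in \mathcal{H}^{n\times m}_{\infty}$, and $P_{3}\in \mathcal{SH}^{m}_{\infty}$ be arbitrary. The following are equivalent: (i) $P=\begin{bmatrix} P_{1} & P_{2}\\ P_{2}^{T} & P_{3}\end{bmatrix}\in \mathcal{H}^{(n+m)+*}_{\infty}$; (ii) $P_{3}\in \mathcal{H}^{m+*}_{\infty}$ and $P_{1}-P_{2}P_{3}^{-1}P_{2}^{T}\in \mathcal{H}^{n+*}_{\infty}$; (iii) $P_{1}\in \mathcal{H}^{n+*}_{\infty}$ and $P_{3}-P_{2}^{T}P_{1}^{-1}P_{2}\in \mathcal{H}^{m+*}_{\infty}$.
   Context: $\Theta$ is a Borel subset of a separable complete metric space, $\mathcal{B}(\Theta)$ its Borel $\sigma$-algebra, $\mu$ a $\sigma$-finite measure on $\mathcal{B}(\Theta)$. Matrices are real with the spectral norm; $\mathbb{S}^n$ is the set of symmetric $n\times n$ real matrices. $\mathcal{H}^{n\times m}_{\infty}$ is the space of measurable $P:\Theta\to\mathbb{R}^{n\times m}$ with $\|P\|_{\mathcal{H}^{n\times m}_\infty}:=\operatorname{ess\,sup}_{\ell\in\Theta}\|P(\ell)\|<\infty$; $\mathcal{SH}^n_\infty$ is the subspace of $\mathcal{H}^{n\times n}_{\infty}$ of $\mathbb{S}^n$-valued functions. $\mathcal{H}^{n+*}_\infty$ is the set of $P\in\mathcal{SH}^n_\infty$ for which there is $\xi>0$ with $P(\ell)\ge \xi I$ for $\mu$-almost every $\ell\in\Theta$.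 Products, transposes and inverses of matrix functions are taken pointwise, and all properties are understood $\mu$-almost everywhere. *)

(* Defs.v *)
From HB Require Import structures.
From mathcomp Require Import all_boot all_order all_algebra.
From mathcomp Require Import sesquilinear.
From mathcomp Require Import all_classical all_reals all_analysis.
From mathcomp Require Import ess_sup_inf.

Set Implicit Arguments.
Unset Strict Implicit.
Unset Printing Implicit Defensive.

Import Order.TTheory GRing.Theory Num.Theory.
Import numFieldNormedType.Exports.

Local Open Scope classical_set_scope.
Local Open Scope ring_scope.

#[short(type="completeMetricType")]
HB.structure Definition CompleteMetric (K : numDomainType) :=
  {M of Metric K M & Complete M}.

Definition separable (T : topologicalType) : Prop :=
  exists2 D : set T, countable D & dense D.

Notation borel T := (@g_sigma_algebraType T open).

(* The set A as a space of its own, with the subspace topology. The proof of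
   non-emptiness is needed because every measurableType carries a point. *)
Definition subspace_of (X : topologicalType) (A : set X) (A0 : A !=set0) : Type :=
  set_type A.

HB.instance Definition _ (X : topologicalType) (A : set X) (A0 : A !=set0) :=
  Topological.copy (subspace_of A0) (set_type A).

HB.instance Definition _ (X : topologicalType) (A : set X) (A0 : A !=set0) :=
  isPointed.Build (subspace_of A0)
    (let: exist x Ax := cid A0 in exist _ x (mem_set Ax)).

(* The library norm `|x| on matrices is the maximum of the moduli of the
   entries; the Euclidean and the spectral norm are therefore defined here. *)
Definition euclidean_norm (R : realType) n (x : 'cV[R]_n) : R :=
  Num.sqrt (\sum_(i < n) x i 0 ^+ 2).

Definition spectral_norm (R : realType) n m (A : 'M[R]_(n, m)) : R :=
  sup [set euclidean_norm (A *m x) | x in [set x | euclidean_norm x <= 1]].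

Definition psdmx (R : realType) n (A : 'M[R]_n) : Prop :=
  A \is symmetricmx /\ forall x : 'cV[R]_n, 0 <= (x^T *m A *m x) 0 0.

Definition loewner_le (R : realType) n (A B : 'M[R]_n) : Prop := psdmx (B - A).

Section matrix_function_spaces.
Context d (T : measurableType d) (R : realType).
Variable mu : {measure set T -> \bar R}.

Definition Hoo_norm n m (P : T -> 'M[R]_(n, m)) : \bar R :=
  ess_sup mu (fun l => (spectral_norm (P l))%:E).

Definition Hoo n m (P : T -> 'M[R]_(n, m)) : Prop :=
  measurable_fun [set: T] (P : T -> borel 'M[R]_(n, m)) /\
  (Hoo_norm P < +oo)%E.

(* Symmetry is required almost everywhere only, as elements of Hoo are
   identified when they agree mu-almost everywhere. *)
Definition SHoo n (P : T -> 'M[R]_n) : Prop :=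
  Hoo P /\ {ae mu, forall l, P l \is symmetricmx}.

Definition Hoo_pos n (P : T -> 'M[R]_n) : Prop :=
  SHoo P /\ exists2 xi : R, 0 < xi & {ae mu, forall l, loewner_le xi%:M (P l)}.

End matrix_function_spaces.

(* Main.v *)
(* Completing the square gives, with [S = A - B D^-1 B^T] and [K = D^-1 B^T],
   [z^T P z = x^T S x + (y + K x)^T D (y + K x)] for [z = (x, y)] and
   [P = [A, B; B^T, D]]. Taking [x = 0], respectively [y = - K x], shows
   that [D] and [S] inherit the coercivity constant of [P]. Conversely, a lower
   bound [D >= xi I] bounds the entries of [D^-1] by [1 / xi], so that [K] is
   essentially bounded, and the constants of [D] and [S] yield one for [P] that
   depends only on them and on the bound on [K], hence not on the point of [Theta]. The criterion in
   terms of [A] is the one in terms of [D] for the block matrix with its two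
   diagonal blocks exchanged. *)
Require Import Defs.
From mathcomp Require Import all_boot all_order all_algebra.
From mathcomp Require Import sesquilinear ring lra.
From mathcomp Require Import all_classical all_reals all_analysis.
From mathcomp Require Import ess_sup_inf measurable_realfun.

Set Implicit Arguments.
Unset Strict Implicit.
Unset Printing Implicit Defensive.

Import Order.TTheory GRing.Theory Num.Theory.
Import numFieldNormedType.Exports.

Local Open Scope classical_set_scope.
Local Open Scope ring_scope.

(** * Quadratic forms and coercive matrices *)

Section quadratic_forms.
Context {R : realType}.

Definition sqnorm n (x : 'cV[R]_n) : R := \sum_i x i 0 ^+ 2.

Definition qform n (A : 'M[R]_n) (x : 'cV[R]_n) : R := (x^T *m A *m x) 0 0.

Lemma sqnorm_ge0 n (x : 'cV[R]_n) : 0 <= sqnorm x.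
Proof. by apply: sumr_ge0 => i _; exact: sqr_ge0. Qed.

Lemma sqr_le_sqnorm n (x : 'cV[R]_n) i : x i 0 ^+ 2 <= sqnorm x.
Proof.
by rewrite /sqnorm (bigD1 i)//= lerDl sumr_ge0// => j _; exact: sqr_ge0.
Qed.

Lemma sqnorm_eq0 n (x : 'cV[R]_n) : sqnorm x <= 0 -> x = 0.
Proof.
move=> x0; apply/matrixP => i j; rewrite ord1 mxE; apply/eqP.
by rewrite -sqrf_eq0 eq_le sqr_ge0 andbT (le_trans (sqr_le_sqnorm x i)).
Qed.

Lemma sqnorm_col_mx n m (x : 'cV[R]_n) (y : 'cV[R]_m) :
  sqnorm (col_mx x y) = sqnorm x + sqnorm y.
Proof.
rewrite /sqnorm big_split_ord/=; congr (_ + _); apply: eq_bigr => i _.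
  by rewrite col_mxEu.
by rewrite col_mxEd.
Qed.

Lemma sqnorm_le_addr n (x y : 'cV[R]_n) :
  sqnorm y <= 2 * sqnorm (y + x) + 2 * sqnorm x.
Proof.
rewrite /sqnorm !mulr_sumr -big_split/=; apply: ler_sum => i _.
(* In each entry the right side minus the left side is the square $(y_i + 2 x_i)^2$. *)
by rewrite mxE; have := sqr_ge0 (y i 0 + 2 * x i 0); nra.
Qed.

Lemma sqnorm_delta n (j : 'I_n) : sqnorm (delta_mx j 0) = 1.
Proof.
rewrite /sqnorm (bigD1 j)//= big1 ?addr0 ?mxE ?eqxx ?expr1n// => i ij.
by rewrite mxE (negbTE ij) expr0n.
Qed.

Lemma sqnorm_mulmx_le n m (A : 'M[R]_(n, m)) (M : R) (x : 'cV[R]_m) :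
  (forall i j, `|A i j| <= M) ->
  sqnorm (A *m x) <= (m%:R * M) ^+ 2 *+ n * sqnorm x.
Proof.
move=> AM.
have sum_cst k (c : R) : c *+ k = \sum_(i < k) c.
  by rewrite sumr_const card_ord.
rewrite {1}/sqnorm mulrnAl sum_cst.
apply: ler_sum => i _; rewrite mxE -[leLHS]real_normK ?num_real//.
rewrite -(sqr_sqrtr (sqnorm_ge0 x)) -exprMn lerXn2r ?nnegrE//.
  (* The bound [AM] forces [0 <= M] only if [A] has a column; for [m = 0] the factor [m%:R] vanishes
     instead. *)
  case: m A x AM => [|m] A x AM; first by rewrite !mul0r.
  rewrite !mulr_ge0 ?sqrtr_ge0//; exact: le_trans (AM i ord0).
apply: le_trans (ler_norm_sum _ _ _) _.
rewrite -mulrA mulr_natl sum_cst.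
apply: ler_sum => j _; rewrite normrM ler_pM//.
by rewrite -sqrtr_sqr ler_wsqrtr// sqr_le_sqnorm.
Qed.

Lemma qform_scalar n a (x : 'cV[R]_n) : qform a%:M x = a * sqnorm x.
Proof.
rewrite /qform mul_mx_scalar -scalemxAl !mxE; congr (_ * _).
by apply: eq_bigr => i _; rewrite !mxE.
Qed.

Lemma qformB n (A B : 'M[R]_n) x : qform (A - B) x = qform A x - qform B x.
Proof. by rewrite /qform mulmxBr mulmxBl !mxE. Qed.

(** A 1 by 1 matrix equals its transpose. *)
Lemma bilinear_tr n m (B : 'M[R]_(n, m)) (x : 'cV[R]_n) (y : 'cV[R]_m) :
  (y^T *m B^T *m x) 0 0 = (x^T *m B *m y) 0 0.
Proof.
by rewrite -[RHS](mxE trmx_key (fun i j => (x^T *m B *m y) j i)) -/(trmx _)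
  !trmx_mul trmxK mulmxA.
Qed.

Lemma qform_block n m (A : 'M[R]_n) (B : 'M[R]_(n, m)) (D : 'M[R]_m) x y :
  qform (block_mx A B B^T D) (col_mx x y) =
  qform A x + (x^T *m B *m y) 0 0 *+ 2 + qform D y.
Proof.
rewrite /qform tr_col_mx mul_row_block mul_row_col !mulmxDl.
have addE (u v : 'M[R]_1) : (u + v) 0 0 = u 0 0 + v 0 0 by rewrite mxE.
by rewrite !addE bilinear_tr mulr2n !addrA.
Qed.

Lemma symmetricmxE n (A : 'M[R]_n) : (A \is symmetricmx) = (A^T == A).
Proof. by rewrite qualifE/= expr0 scale1r map_mx_id// eq_sym. Qed.

Definition coercive n (a : R) (A : 'M[R]_n) :=
  A^T = A /\ forall x, a * sqnorm x <= qform A x.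

Lemma loewner_le_coercive n a (A : 'M[R]_n) :
  loewner_le a%:M A <-> coercive a A.
Proof.
rewrite /loewner_le /psdmx symmetricmxE linearB/= tr_scalar_mx.
split=> -[AT A0]; split.
- by move/eqP: AT => /addIr.
- by move=> x; rewrite -subr_ge0 -qform_scalar -qformB; exact: A0.
- by rewrite AT.
- by move=> x; rewrite -/(qform _ _) qformB qform_scalar subr_ge0.
Qed.

Lemma coerciveW n a b (A : 'M[R]_n) : b <= a -> coercive a A -> coercive b A.
Proof.
move=> ba [AT aA]; split=> // x; apply: le_trans (aA x).
by rewrite ler_wpM2r ?sqnorm_ge0.
Qed.

Lemma coercive_unitmx n a (A : 'M[R]_n) : 0 < a -> coercive a A -> A \in unitmx.
Proof.
move=> a0 [_ aA]; rewrite unitmxE unitfE; apply/det0P => -[v /eqP v0 vA].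
apply: v0; apply: (can_inj trmxK); rewrite trmx0; apply: sqnorm_eq0.
have := aA v^T; rewrite /qform trmxK vA mul0mx mxE.
by rewrite pmulr_rle0.
Qed.

(** The column $w = A^{-1} e_j$ satisfies $w^T A w = w_j$, so $a w_k^2 \le w_j$ for every $k$.
    Taking $k = j$ gives $w_j \le 1/a$, and then $k = i$ gives $w_i^2 \le 1/a^2$. *)
Lemma coercive_invmx_le n a (A : 'M[R]_n) i j :
  0 < a -> coercive a A -> `|invmx A i j| <= a^-1.
Proof.
move=> a0 aA; have uA := coercive_unitmx a0 aA.
set w := col j (invmx A).
have wE k : w k 0 = invmx A k j by rewrite mxE.
have Aw : A *m w = delta_mx j 0.
  by rewrite /w colE mulmxA mulmxV// mul1mx.
have qw : qform A w = w j 0.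
  by rewrite /qform -mulmxA Aw -colE !mxE.
have w_le k : a * w k 0 ^+ 2 <= w j 0.
  rewrite -qw; apply: le_trans (aA.2 w).
  by rewrite ler_pM2l// sqr_le_sqnorm.
have wj : w j 0 <= a^-1.
  have [wj0|wj0] := leP (w j 0) 0; first by
    rewrite (le_trans wj0)// invr_ge0 ltW.
  rewrite -(ler_pM2l a0) divff ?gt_eqF// -(ler_pM2r wj0) mul1r -mulrA -expr2.
  exact: w_le.
rewrite -wE -(@ler_pXn2r _ 2) ?nnegrE ?invr_ge0 ?(ltW a0)//.
rewrite real_normK ?num_real// -(ler_pM2l a0) (le_trans (w_le i))//.
rewrite (le_trans wj)//.
by rewrite expr2 mulrA divff ?gt_eqF// mul1r.
Qed.

(** * Completing the square and the pointwise Schur criterion *)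

Section schur_complement.
Variables (n m : nat) (A : 'M[R]_n) (B : 'M[R]_(n, m)) (D : 'M[R]_m).
Hypotheses (DT : D^T = D) (uD : D \in unitmx).

Let S := A - B *m invmx D *m B^T.
Let K := invmx D *m B^T.

Lemma qform_block_schur x y :
  qform (block_mx A B B^T D) (col_mx x y) = qform S x + qform D (y + K *m x).
Proof.
rewrite qform_block qformB /qform.
(* By [KT] and [DK], expanding the form of [D] at $y + Kx$ yields the cross term $x^T B y$ twice,
   and a term $x^T B K x$ that cancels the one subtracted in [S]. *)
have KT : K^T *m D = B by rewrite trmx_mul trmxK trmx_inv DT mulmxKV.
have DK : D *m K = B^T by rewrite mulmxA mulmxV// mul1mx.
have -> : x^T *m (B *m invmx D *m B^T) *m x = x^T *m B *m K *m x.
  by rewrite /K !mulmxA.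
rewrite [(y + _)^T]linearD/= [(K *m x)^T]trmx_mul 2!mulmxDl 2!mulmxDr.
rewrite -[x^T *m K^T *m D]mulmxA KT.
rewrite [y^T *m D *m (K *m x)]mulmxA -[y^T *m D *m K]mulmxA DK.
rewrite [x^T *m B *m (K *m x)]mulmxA.
have addE (u v : 'M[R]_1) : (u + v) 0 0 = u 0 0 + v 0 0 by rewrite mxE.
rewrite !addE bilinear_tr; ring.
Qed.

End schur_complement.

Lemma coercive_schur n m (A : 'M[R]_n) (B : 'M[R]_(n, m)) (D : 'M[R]_m) a :
  0 < a -> coercive a (block_mx A B B^T D) ->
  coercive a D /\ coercive a (A - B *m invmx D *m B^T).
Proof.
move=> a0 [PT aP].
have [AT _ _ DT] : [/\ A^T = A, B^T^T = B, B^T = B^T & D^T = D].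
  by move: PT; rewrite tr_block_mx => /eq_block_mx[-> -> _ ->].
have aD : coercive a D.
  split=> // y; have := aP (col_mx 0 y).
  rewrite sqnorm_col_mx qform_block /qform trmx0 !mul0mx mxE mul0rn !add0r.
  by rewrite [sqnorm 0]big1 ?add0r// => i _; rewrite mxE expr0n.
have uD := coercive_unitmx a0 aD; split=> //; split=> [|x].
  by rewrite linearB/= !trmx_mul trmxK trmx_inv DT AT mulmxA.
(* At this vector the square vanishes, and its norm is at least that of [x], so the constant [a] is
   kept. *)
have := aP (col_mx x (- (invmx D *m B^T *m x))).
rewrite sqnorm_col_mx qform_block_schur// addNr.
rewrite [qform D 0]/qform mulmx0 mxE addr0; apply: le_trans.
by rewrite ler_pM2l// lerDl sqnorm_ge0.
Qed.

(* From [|y|^2 <= 2 |y + K x|^2 + 2 c |x|^2], keeping only the fraction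
   [1 / (2 (c + 1))] of the second square of [qform_block_schur] leaves half of
   the first one, [a |x|^2], to absorb the error term in [|x|^2]. *)
Lemma schur_coercive n m (A : 'M[R]_n) (B : 'M[R]_(n, m)) (D : 'M[R]_m) a c :
  0 < a -> 0 <= c ->
  (forall x, sqnorm (invmx D *m B^T *m x) <= c * sqnorm x) ->
  coercive a D -> coercive a (A - B *m invmx D *m B^T) ->
  coercive (a / (4 * (c + 1))) (block_mx A B B^T D).
Proof.
move=> a0 c0 Kc aD [ST aS]; have uD := coercive_unitmx a0 aD.
have [DT aD'] := aD; split=> [|z].
  rewrite tr_block_mx trmxK DT; congr block_mx.
  move: ST; rewrite linearB/= !trmx_mul trmxK trmx_inv DT mulmxA.
  by move/addIr.
rewrite -[z]vsubmxK; set x := usubmx z; set y := dsubmx z.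
rewrite sqnorm_col_mx qform_block_schur//.
have := aS x; have := aD' (y + invmx D *m B^T *m x); have := Kc x.
have := sqnorm_le_addr (invmx D *m B^T *m x) y.
set k := sqnorm (_ *m x); set s := sqnorm (_ + _).
have := sqnorm_ge0 x; have := sqnorm_ge0 y; have s0 : 0 <= s := sqnorm_ge0 _.
move: (sqnorm x) (sqnorm y) => X Y Y0 X0 Ys kX.
move: (qform _ _) (qform _ _) => q1 q2 s1 X2.
(* Dividing by [a] leaves $X + Y \le 4(c+1)(X+s)$, which follows from $Y \le 2s + 2cX$. *)
apply: le_trans (lerD X2 s1); rewrite -mulrDr -mulrA ler_pM2l//.
rewrite mulrC ler_pdivrMr ?mulr_gt0 ?ltr_wpDl//.
by have := mulr_ge0 c0 s0; have := mulr_ge0 c0 X0; nra.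
Qed.

Lemma coercive_block_swap n m (A : 'M[R]_n) (B : 'M[R]_(n, m)) (D : 'M[R]_m) a :
  coercive a (block_mx A B B^T D) -> coercive a (block_mx D B^T B A).
Proof.
move=> [PT aP]; split=> [|z].
  by move: PT; rewrite !tr_block_mx trmxK => /eq_block_mx[-> _ _ ->].
rewrite -[z]vsubmxK; have := aP (col_mx (dsubmx z) (usubmx z)).
(* The lower left block is written as [B^T^T] to match the shape of [qform_block]. *)
rewrite -{4}[B]trmxK !sqnorm_col_mx !qform_block addrC.
rewrite bilinear_tr => /le_trans; apply.
by rewrite addrC [in leRHS]addrAC addrA.
Qed.


(** * Comparison of the spectral norm with the entries *)

Lemma euclidean_norm_mulmx_le n m (A : 'M[R]_(n, m)) M (x : 'cV[R]_m) :
  (forall i j, `|A i j| <= M) -> euclidean_norm x <= 1 ->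
  euclidean_norm (A *m x) <= Num.sqrt ((m%:R * M) ^+ 2 *+ n).
Proof.
rewrite -[X in _ <= X]sqrtr1 ler_sqrt// => AM x1.
apply/ler_wsqrtr/(le_trans (sqnorm_mulmx_le x AM)).
by rewrite ler_piMr// mulrn_wge0// sqr_ge0.
Qed.

(** With [entry_le_spectral_norm], this reduces essential boundedness in the spectral norm to that
    of the entries. *)
Lemma spectral_norm_le n m (A : 'M[R]_(n, m)) M :
  (forall i j, `|A i j| <= M) ->
  spectral_norm A <= Num.sqrt ((m%:R * M) ^+ 2 *+ n).
Proof.
move=> AM; apply: ge_sup; last first.
  by move=> _ [x /= x1 <-]; exact: euclidean_norm_mulmx_le.
exists (euclidean_norm (A *m 0)), 0 => //=.
rewrite /euclidean_norm big1 ?sqrtr0 ?ler01// => i _.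
by rewrite mxE expr0n.
Qed.

Lemma entry_le_spectral_norm n m (A : 'M[R]_(n, m)) i j :
  `|A i j| <= spectral_norm A.
Proof.
(* This crude bound only serves to show that the set defining the spectral norm is bounded above, so
   that its [sup] is an upper bound. *)
pose M := \sum_k \sum_l `|A k l|.
have AM k l : `|A k l| <= M.
  rewrite /M (bigD1 k)//= (bigD1 l)//= -addrA lerDl addr_ge0 ?sumr_ge0// => p _.
  by rewrite sumr_ge0.
apply: (@le_trans _ _ (euclidean_norm (A *m delta_mx j 0))).
  rewrite -sqrtr_sqr ler_wsqrtr//.
  apply: le_trans (sqr_le_sqnorm (A *m delta_mx j 0) i).
  by rewrite -colE mxE.
apply: ub_le_sup; last first.
  by exists (delta_mx j 0) => //=; rewrite /euclidean_norm -/(sqnorm _)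
    sqnorm_delta sqrtr1.
exists (Num.sqrt ((m%:R * M) ^+ 2 *+ n)) => _ [x /= x1 <-].
exact: euclidean_norm_mulmx_le.
Qed.

End quadratic_forms.

(** * Measurability of matrix functions through their entries *)

Section measurability.
Context d (T : measurableType d) {R : realType}.

Lemma open_coord n m (i : 'I_n) (j : 'I_m) (U : set R) :
  open U -> open [set M : 'M[R]_(n, m) | U (M i j)].
Proof.
rewrite !openE => oU M /= /oU UM.
exists (fun k l => if (k == i) && (l == j) then U else setT) => /=.
  move=> k l; case: ifPn => [/andP[/eqP-> /eqP->]//|_]; exact: filterT.
by move=> N /(_ i j); rewrite !eqxx.
Qed.

(* Every open set of matrices is a countable union of boxes with rational
   centre. *)
Lemma measurable_mxP n m (P : T -> 'M[R]_(n, m)) :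
  measurable_fun [set: T] (P : T -> borel 'M[R]_(n, m)) <->
  forall i j, measurable_fun [set: T] (fun l => P l i j).
Proof.
split=> [mP i j|mP].
  apply: (measurability _ (RGenOpens.measurableE R)) => _ [_ [a [b ->] <-]].
  apply: (mP measurableT [set M | `]a, b[%classic (M i j)]).
  by apply: sub_sigma_algebra; apply: open_coord; exact: interval_open.
apply: (@measurability _ _ T (borel 'M[R]_(n, m)) setT P open) => //.
move=> _ [U oU <-]; rewrite setTI.
pose c := map_mx (ratr : rat -> R).
pose B (qk : 'M[rat]_(n, m) * nat) := ball (c _ _ qk.1) qk.2.+1%:R^-1.
have -> : P @^-1` U = \bigcup_(qk in [set qk | B qk `<=` U]) (P @^-1` (B qk)).
  apply/seteqP; split=> [l Ul|l [qk BU]]; last exact: BU.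
  have /nbhs_ballP[e /= e0 eU] : nbhs (P l) U by exact: open_nbhs_nbhs.
  (* The radius $1/(k+1)$ is at most $e/2$: a ball of this radius that contains [P l] stays within
     distance [e] of [P l]. *)
  pose k := Num.truncn (2 / e).
  have k0 : 0 < k.+1%:R^-1 :> R by rewrite invr_gt0.
  have ke : 2 * k.+1%:R^-1 <= e.
    rewrite ler_pdivrMr// -ler_pdivrMl// mulrC; exact/ltW/truncnS_gt.
  have /(_ _ _)/cid q_ex i j : exists q : rat, `|ratr q - P l i j| < k.+1%:R^-1.
    have [|q] := @rat_in_itvoo R (P l i j - k.+1%:R^-1) (P l i j + k.+1%:R^-1).
      by rewrite ltrD2l gtrN.
    by rewrite in_itv/= => ?; exists q; rewrite ltr_distl.
  exists (\matrix_(i, j) projT1 (q_ex i j), k); last first.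
    by split=> // i j; rewrite !mxE; exact: (projT2 (q_ex i j)).
  move=> N [_ BN]; apply: eU; split=> // i j.
  apply: le_ball ke _ _; rewrite mulr_natl mulr2n.
  have Pq : ball (P l i j) k.+1%:R^-1 (ratr (projT1 (q_ex i j)) : R).
    by apply: ball_sym; exact: (projT2 (q_ex i j)).
  by apply: (ball_triangle Pq); have := BN i j; rewrite !mxE.
rewrite bigcup_mkcond; apply: countable_bigcupT_measurable => [|qk].
  exact: countableP.
case: ifPn => // _.
have -> : P @^-1` B qk = \bigcap_(ij in [set: 'I_n * 'I_m])
    ((fun l => P l ij.1 ij.2) @^-1` ball (c _ _ qk.1 ij.1 ij.2) qk.2.+1%:R^-1).
  apply/seteqP; split=> [l [_ Bl] [i j] _|l Bl]; first exact: Bl.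
  by split=> // i j; exact: (Bl (i, j)).
apply: fin_bigcap_measurable => // -[i j] _.
rewrite -[X in measurable X]setTI; apply: mP => //; exact: measurable_ball.
Qed.

(** Inversion is continuous off 0, and any function is measurable on the singleton of 0. *)
Lemma measurable_inv : measurable_fun [set: R] (@GRing.inv R).
Proof.
rewrite -(setvU [set 0]); apply/measurable_funU => //; first exact: measurableC.
split.
  apply: open_continuous_measurable_fun.
    by rewrite openC; exact: closed_eq.
  by move=> x; rewrite inE => /eqP; exact: inv_continuous.
exact: measurable_fun_set1.
Qed.

Lemma measurable_det n (P : T -> 'M[R]_n) :
  (forall i j, measurable_fun [set: T] (fun l => P l i j)) ->
  measurable_fun [set: T] (fun l => \det (P l)).
Proof.
move=> mP; apply: measurable_sum => s; apply: measurable_funM => //.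
by apply: measurable_prod => i _.
Qed.

Lemma measurable_invmx n (P : T -> 'M[R]_n) :
  (forall i j, measurable_fun [set: T] (fun l => P l i j)) ->
  forall i j, measurable_fun [set: T] (fun l => invmx (P l) i j).
Proof.
move=> mP i j.
(* This is the adjugate formula; on singular matrices [invmx] returns its argument, whence the first
   branch. *)
have -> : (fun l => invmx (P l) i j) =
    (fun l => if \det (P l) == 0 then P l i j
              else (\det (P l))^-1 * cofactor (P l) j i).
  apply/funext => l; rewrite /invmx unitmxE unitfE.
  by case: eqP => //= _; rewrite !mxE.
apply: measurable_fun_if => //.
- by apply: measurable_fun_eqr => //; exact: measurable_det.
- exact: measurable_funS (mP i j).
apply: (@measurable_funS _ _ _ _ setT) => //.
apply: measurable_funM.
  apply: (measurableT_comp measurable_inv); exact: measurable_det.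
apply: measurable_funM => //; apply: measurable_det => k l.
rewrite (_ : (fun _ => _) = fun t => P t (lift j k) (lift i l))//.
by apply/funext => t; rewrite !mxE.
Qed.

End measurability.

(** * Essentially bounded matrix functions and their algebra *)

Section essentially_bounded.
Context d (T : measurableType d) (R : realType).
Variable mu : {measure set T -> \bar R}.

Definition ae_bounded (f : T -> R) : Prop :=
  exists M, {ae mu, forall l, `|f l| <= M}.

Definition Linfty (f : T -> R) : Prop :=
  measurable_fun [set: T] f /\ ae_bounded f.

Lemma LinftyD f g : Linfty f -> Linfty g -> Linfty (fun l => f l + g l).
Proof.
move=> [mf [M fM]] [mg [N gN]]; split; first exact: measurable_funD.
exists (M + N); near=> l; apply: le_trans (ler_normD _ _) _; apply: lerD.
  by near: l.
by near: l.
Unshelve. all: by end_near. Qed.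

Lemma LinftyM f g : Linfty f -> Linfty g -> Linfty (fun l => f l * g l).
Proof.
move=> [mf [M fM]] [mg [N gN]]; split; first exact: measurable_funM.
exists (M * N); near=> l; rewrite normrM; apply: ler_pM => //.
  by near: l.
by near: l.
Unshelve. all: by end_near. Qed.

Lemma LinftyN f : Linfty f -> Linfty (fun l => - f l).
Proof.
move=> [mf [M fM]]; split; first exact: measurable_funN.
by exists M; apply: filterS fM => l; rewrite normrN.
Qed.

Lemma Linfty_sum I (s : seq I) (f : I -> T -> R) :
  (forall i, Linfty (f i)) -> Linfty (fun l => \sum_(i <- s) f i l).
Proof.
move=> fL; elim: s => [|i s ih].
  rewrite (_ : (fun _ => _) = cst 0); last first.
    by apply/funext => l; rewrite big_nil.
  by split=> //; exists 0; apply: aeW => l; rewrite normr0.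
under eq_fun do rewrite big_cons.
exact: LinftyD.
Qed.

(** Finitely many null sets have a null union, and the sum of the $|M_i|$ dominates each bound. *)
Lemma ae_bounded_fin (I : finType) (f : I -> T -> R) :
  (forall i, ae_bounded (f i)) ->
  exists2 M, 0 <= M & {ae mu, forall l i, `|f i l| <= M}.
Proof.
move=> /choice[M fM]; exists (\sum_i `|M i|); first exact: sumr_ge0.
apply: filter_forall => i; apply: filterS (fM i) => l /le_trans; apply.
by rewrite (bigD1 i)//= (le_trans (ler_norm _))// lerDl sumr_ge0.
Qed.

Lemma HooP n m (P : T -> 'M[R]_(n, m)) :
  Hoo mu P <-> forall i j, Linfty (fun l => P l i j).
Proof.
rewrite /Hoo measurable_mxP; split=> [[mP Poo] i j|PL].
  have [M /ess_supP PM] : exists M, (Hoo_norm mu P <= M%:E)%E.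
    move: Poo; case: (Hoo_norm mu P) => [M| |]// _; first by exists M.
    (* The essential supremum can be $-\infty$, for instance if [mu] is zero; any real is then a
       bound. *)
    by exists 0; exact: leNye.
  split=> //; exists M; apply: filterS PM => l; rewrite lee_fin.
  apply: le_trans.
  exact: entry_le_spectral_norm.
split=> [i j|]; first exact: (PL i j).1.
have [|M M0 PM] := @ae_bounded_fin _
    (fun (ij : 'I_n * 'I_m) l => P l ij.1 ij.2).
  by move=> ij; exact: (PL _ _).2.
apply: (@le_lt_trans _ _ (Num.sqrt ((m%:R * M) ^+ 2 *+ n))%:E); last first.
  exact: ltry.
apply/ess_supP; apply: filterS PM => l PM; rewrite lee_fin.
by apply: spectral_norm_le => i j; exact: (PM (i, j)).
Qed.

Lemma HooB n m (P Q : T -> 'M[R]_(n, m)) :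
  Hoo mu P -> Hoo mu Q -> Hoo mu (fun l => P l - Q l).
Proof.
move=> /HooP PL /HooP QL; apply/HooP => i j.
under eq_fun do rewrite 2!mxE.
by apply: LinftyD => //; exact: LinftyN.
Qed.

Lemma Hoo_mulmx n m p (P : T -> 'M[R]_(n, m)) (Q : T -> 'M[R]_(m, p)) :
  Hoo mu P -> Hoo mu Q -> Hoo mu (fun l => P l *m Q l).
Proof.
move=> /HooP PL /HooP QL; apply/HooP => i j.
under eq_fun do rewrite mxE.
by apply: Linfty_sum => k; exact: LinftyM.
Qed.

Lemma Hoo_trmx n m (P : T -> 'M[R]_(n, m)) :
  Hoo mu P -> Hoo mu (fun l => (P l)^T).
Proof.
move=> /HooP PL; apply/HooP => i j.
by under eq_fun do rewrite mxE.
Qed.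

Lemma Hoo_block_mx n1 n2 m1 m2
    (A : T -> 'M[R]_(n1, m1)) (B : T -> 'M[R]_(n1, m2))
    (C : T -> 'M[R]_(n2, m1)) (D : T -> 'M[R]_(n2, m2)) :
  Hoo mu A -> Hoo mu B -> Hoo mu C -> Hoo mu D ->
  Hoo mu (fun l => block_mx (A l) (B l) (C l) (D l)).
Proof.
move=> /HooP AL /HooP BL /HooP CL /HooP DL; apply/HooP => i j.
case: (split_ordP i) => k ->; case: (split_ordP j) => h ->.
- by under eq_fun do rewrite block_mxEul.
- by under eq_fun do rewrite block_mxEur.
- by under eq_fun do rewrite block_mxEdl.
- by under eq_fun do rewrite block_mxEdr.
Qed.

Definition ae_coercive n (P : T -> 'M[R]_n) : Prop :=
  exists2 a : R, 0 < a & {ae mu, forall l, coercive a (P l)}.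

(** Coercivity includes symmetry, so it gives back the symmetry clause of [SHoo]. *)
Lemma Hoo_posP n (P : T -> 'M[R]_n) :
  Hoo_pos mu P <-> Hoo mu P /\ ae_coercive P.
Proof.
split=> [[[PH _] [a a0 aP]]|[PH [a a0 aP]]].
  split=> //; exists a => //; apply: filterS aP => l.
  by move/loewner_le_coercive.
split; first split=> //.
  by apply: filterS aP => l [PT _]; rewrite symmetricmxE PT.
by exists a => //; apply: filterS aP => l; move/loewner_le_coercive.
Qed.

Lemma Hoo_invmx n (P : T -> 'M[R]_n) :
  Hoo_pos mu P -> Hoo mu (fun l => invmx (P l)).
Proof.
move=> /Hoo_posP[/HooP PL [a a0 aP]]; apply/HooP => i j; split.
  by apply: measurable_invmx => k h; exact: (PL k h).1.
by exists a^-1; apply: filterS aP => l; exact: coercive_invmx_le.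
Qed.

(** * The Schur criterion for matrix functions *)

Section block.
Variables (n m : nat) (A : T -> 'M[R]_n) (B : T -> 'M[R]_(n, m)).
Variable D : T -> 'M[R]_m.
Hypotheses (AH : Hoo mu A) (BH : Hoo mu B) (DH : Hoo mu D).

Lemma Hoo_pos_schur :
  Hoo_pos mu (fun l => block_mx (A l) (B l) (B l)^T (D l)) <->
  Hoo_pos mu D /\ Hoo_pos mu (fun l => A l - B l *m invmx (D l) *m (B l)^T).
Proof.
(* Positivity of [D] is assumed here because it makes the inverse essentially bounded. *)
have SH : Hoo_pos mu D -> Hoo mu (fun l => A l - B l *m invmx (D l) *m (B l)^T).
  move=> Dp; apply: (HooB AH (Hoo_mulmx _ (Hoo_trmx BH))).
  exact: (Hoo_mulmx BH (Hoo_invmx Dp)).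
split=> [/Hoo_posP[_ [a a0 aP]]|[Dp Sp]].
  have Dp : Hoo_pos mu D.
    by apply/Hoo_posP; split=> //; exists a => //; apply: filterS aP => l
      /(coercive_schur a0)[].
  split=> //; apply/Hoo_posP; split; first exact: SH.
  by exists a => //; apply: filterS aP => l /(coercive_schur a0)[].
apply/Hoo_posP; split; first exact: (Hoo_block_mx AH BH (Hoo_trmx BH) DH).
have /HooP KL : Hoo mu (fun l => invmx (D l) *m (B l)^T).
  exact: (Hoo_mulmx (Hoo_invmx Dp) (Hoo_trmx BH)).
have [|M M0 KM] := @ae_bounded_fin _
    (fun (ij : 'I_m * 'I_n) l => (invmx (D l) *m (B l)^T) ij.1 ij.2).
  by move=> ij; exact: (KL _ _).2.
move: Dp Sp => /Hoo_posP[_ [a a0 aD]] /Hoo_posP[_ [b b0 bS]].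
(* [c] is the constant of [sqnorm_mulmx_le] for $D^{-1} B^T$, and [e] is a coercivity constant
   common to [D] and its Schur complement. *)
pose c := (n%:R * M) ^+ 2 *+ m; pose e := Num.min a b.
have c0 : 0 <= c by rewrite mulrn_wge0// sqr_ge0.
have e0 : 0 < e by rewrite lt_min a0.
exists (e / (4 * (c + 1))).
  by rewrite divr_gt0// mulr_gt0// ltr_wpDl.
near=> l; apply: schur_coercive => //.
- move=> x; apply: sqnorm_mulmx_le => i j.
  by have /(_ (i, j)) : forall ij : 'I_m * 'I_n,
    `|(invmx (D l) *m (B l)^T) ij.1 ij.2| <= M by near: l.
- apply: (@coerciveW _ _ a); first by rewrite ge_min lexx.
  by near: l.
- apply: (@coerciveW _ _ b); first by rewrite ge_min lexx orbT.
  by near: l.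
Unshelve. all: by end_near. Qed.

Lemma Hoo_pos_block_swap :
  Hoo_pos mu (fun l => block_mx (A l) (B l) (B l)^T (D l)) ->
  Hoo_pos mu (fun l => block_mx (D l) (B l)^T (B l) (A l)).
Proof.
move=> /Hoo_posP[_ [a a0 aP]]; apply/Hoo_posP; split.
  exact: (Hoo_block_mx DH (Hoo_trmx BH) BH AH).
by exists a => //; apply: filterS aP => l; exact: coercive_block_swap.
Qed.

End block.

End essentially_bounded.

Theorem proposition1 (R : realType) (X : completeMetricType R)
    (sepX : separable X)
    (Theta : set X) (borelTheta : <<s open >> Theta) (Theta0 : Theta !=set0)
    (mu : {sigma_finite_measure set borel (subspace_of Theta0) -> \bar R})
    (n m : nat)
    (P1 : subspace_of Theta0 -> 'M[R]_n)
    (P2 : subspace_of Theta0 -> 'M[R]_(n, m))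
    (P3 : subspace_of Theta0 -> 'M[R]_m)
    (P1_SHoo : SHoo mu P1) (P2_Hoo : Hoo mu P2) (P3_SHoo : SHoo mu P3) :
  [<-> (* (i) *)
       Hoo_pos mu (fun l => block_mx (P1 l) (P2 l) (P2 l)^T (P3 l));
       (* (ii) *)
       Hoo_pos mu P3 /\
       Hoo_pos mu (fun l => P1 l - P2 l *m invmx (P3 l) *m (P2 l)^T);
       (* (iii) *)
       Hoo_pos mu P1 /\
       Hoo_pos mu (fun l => P3 l - (P2 l)^T *m invmx (P1 l) *m P2 l)].
Proof.
have [[H1 _] [H3 _]] := (P1_SHoo, P3_SHoo).
have H2 := Hoo_trmx P2_Hoo.
(* For the blocks in exchanged order the criterion yields (iii), up to the double transposes removed
   below. *)
have schur1 := Hoo_pos_schur H3 H2 H1.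
have blockE : (fun l => block_mx (P3 l) (P2 l)^T ((P2 l)^T)^T (P1 l)) =
              (fun l => block_mx (P3 l) (P2 l)^T (P2 l) (P1 l)).
  by apply/funext => l; rewrite trmxK.
have schurE : (fun l => P3 l - (P2 l)^T *m invmx (P1 l) *m ((P2 l)^T)^T) =
              (fun l => P3 l - (P2 l)^T *m invmx (P1 l) *m P2 l).
  by apply/funext => l; rewrite trmxK.
rewrite blockE schurE in schur1.
tfae.
- by move/(Hoo_pos_schur H1 P2_Hoo H3).
(* From (ii) to (iii) the path goes back through (i) and exchanges the diagonal blocks. *)
- by move/(Hoo_pos_schur H1 P2_Hoo H3)/(Hoo_pos_block_swap H1 P2_Hoo H3)/schur1.
- move/schur1; rewrite -blockE => /(Hoo_pos_block_swap H3 H2 H1).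
  by under eq_fun do rewrite trmxK.
Qed.
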